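(* Let $A$ be a unital Banach algebra and let $X$ be a unital left Banach $A$-module. (1) If $Y$ is a unital left Banach $A$-module and $\phi\colon X\to Y$ is a morphism of Banach $A$-modules, then $\phi(\operatorname{t-rad}X)\subset\operatorname{t-rad}Y$. (2) For $x_0\in X$, the morphism $\tau\colon A\to X$, $a\mapsto a\cdot x_0$, is small if and only if $x_0\in\operatorname{t-rad}X$. (3) $\overline{R\cdot X}\subset\operatorname{t-rad}X$, where $R$ is the Jacobson radical of $A$. (4) $\operatorname{t-rad}(X/\operatorname{t-rad}X)=0$. (5) If $Z$ is a closed submodule of $X$ such that $\operatorname{t-rad}(X/Z)=0$, then $\operatorname{t-rad}X\subset Z$.
   Context: Banach algebras are over $\mathbb{C}$ with $\|ab\|\le\|a\|\|b\|$. A left Banach $A$-module is a Banach space with a left $A$-module structure such that $\|a\cdot x\|\le\|a\|\|x\|$; it is unital if $1\cdot x=x$ for all $x$. A morphism is a bounded $A$-linear map; a monomorphism is an injective morphism; contractive means of norm at most $1$. A morphism $\psi\colon X_0\to X$ is small if for every morphism $\phi\colon Y\to X$ of Banach $A$-modules, $\operatorname{Im}\phi+\operatorname{Im}\psi=X$ implies $\operatorname{Im}\phi=X$. A contractive monomorphism $\alpha\colon Y\to X$ of left unital Banach $A$-modules is maximal if $\alpha$ is not surjective and, for every non-surjective contractive monomorphism $\beta$ with codomain $X$ and every contractive morphism $\kappa$, the equality $\alpha=\beta\kappa$ implies that $\kappa$ is an isometric isomorphism. The topological radical $\operatorname{t-rad}X$ of a left unital Banach $A$-module $X$ is the closed submodule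 $\bigcup\operatorname{Im}\psi=\bigcap\operatorname{Im}\gamma$, where $\psi$ runs over all small morphisms with codomain $X$ and $\gamma$ runs over all maximal contractive monomorphisms with codomain $X$ (an empty intersection being $X$); these two sets coincide and form a closed submodule. $R\cdot X$ denotes the linear span of $\{r\cdot x: r\in R,\ x\in X\}$. *)

(* Defs.v *)
From HB Require Import structures.
From mathcomp Require Import all_boot all_order all_algebra.
From mathcomp Require Import complex lra.
From mathcomp Require Import all_classical all_reals all_analysis.

Set Implicit Arguments.
Unset Strict Implicit.
Unset Printing Implicit Defensive.

Import Order.TTheory GRing.Theory Num.Theory.
Import numFieldNormedType.Exports.

Local Open Scope classical_set_scope.
Local Open Scope ring_scope.
Local Open Scope complex_scope.
Local Open Scope quotient_scope.

(* The product is a field of the structure rather than a ring structure: the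
   library hierarchy has no join of rings and normed modules below
   numDomainType.  Nothing is assumed on `|bone|, and bone = 0 is allowed. *)
HB.mixin Record isBanachAlgebra (R : realType) A
    of CompleteNormedModule R[i] A := {
  bmul : A -> A -> A;
  bone : A;
  bmulA : associative bmul;
  bmul1x : left_id bone bmul;
  bmulx1 : right_id bone bmul;
  bmulPl : forall (k : R[i]) (a b c : A),
    bmul (k *: a + b) c = k *: bmul a c + bmul b c;
  bmulPr : forall (k : R[i]) (a b c : A),
    bmul a (k *: b + c) = k *: bmul a b + bmul a c;
  norm_bmul : forall a b : A, `|bmul a b| <= `|a| * `|b|
}.

#[short(type="banachAlgType")]
HB.structure Definition BanachAlgebra (R : realType) :=
  {A of CompleteNormedModule R[i] A & isBanachAlgebra R A}.

(* Left modules, not assumed unital. *)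
HB.mixin Record isBanachModule (R : realType) (A : banachAlgType R) X
    of CompleteNormedModule R[i] X := {
  act : A -> X -> X;
  actPl : forall (k : R[i]) (a b : A) (x : X),
    act (k *: a + b) x = k *: act a x + act b x;
  actPr : forall (k : R[i]) (a : A) (x y : X),
    act a (k *: x + y) = k *: act a x + act a y;
  actM : forall (a b : A) (x : X), act (bmul a b) x = act a (act b x);
  norm_act : forall (a : A) (x : X), `|act a x| <= `|a| * `|x|
}.

#[short(type="banachModType")]
HB.structure Definition BanachModule (R : realType) (A : banachAlgType R) :=
  {X of CompleteNormedModule R[i] X & isBanachModule R A X}.

Definition unital_module (R : realType) (A : banachAlgType R)
    (X : banachModType A) : Prop :=
  forall x : X, act (bone : A) x = x.

(* A as a left module over itself; an alias, so that the two structures do not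
   compete on the same carrier. *)
Definition regular_module (R : realType) (A : banachAlgType R) : Type := A.

HB.instance Definition _ (R : realType) (A : banachAlgType R) :=
  CompleteNormedModule.on (regular_module A).
HB.instance Definition _ (R : realType) (A : banachAlgType R) :=
  isBanachModule.Build R A (regular_module A) (@bmulPl R A) (@bmulPr R A)
    (fun a b c => esym (bmulA a b c)) (@norm_bmul R A).

Record bmorphism (R : realType) (A : banachAlgType R) (X Y : banachModType A) :=
  BMorphism {
    bmor_fun :> {linear X -> Y};
    bmor_act : forall (a : A) (x : X), bmor_fun (act a x) = act a (bmor_fun x);
    bmor_bounded : exists M : R, forall x : X, `|bmor_fun x| <= M%:C * `|x|
  }.

Definition small (R : realType) (A : banachAlgType R) (X0 X : banachModType A)
    (psi : bmorphism X0 X) : Prop :=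
  forall (Y : banachModType A) (phi : bmorphism Y X),
    [set u + v | u in range phi & v in range psi] = setT -> range phi = setT.

(* For unital X this is also the intersection of the images of the maximal
   contractive monomorphisms with codomain X. *)
Definition trad (R : realType) (A : banachAlgType R) (X : banachModType A) :
    set X :=
  [set x | exists (X0 : banachModType A) (psi : bmorphism X0 X),
     small psi /\ range psi x].
Arguments trad {R A} X.

Section orbit_map.
Context (R : realType) (A : banachAlgType R) (X : banachModType A) (x0 : X).

Definition orbit_fun (a : regular_module A) : X := act (a : A) x0.

Fact orbit_fun_linear : linear orbit_fun.
Proof. by move=> k a b; exact: actPl. Qed.

HB.instance Definition _ :=
  GRing.isLinear.Build R[i] (regular_module A) X *:%R orbit_fun
    orbit_fun_linear.

Fact orbit_fun_act (a : A) (b : regular_module A) :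
  orbit_fun (act a b) = act a (orbit_fun b).
Proof. exact: actM. Qed.

Fact orbit_fun_bounded :
  exists M : R, forall a : regular_module A, `|orbit_fun a| <= M%:C * `|a|.
Proof.
exists (complex.Re `|x0|) => a.
by rewrite RRe_real ?ger0_real// mulrC; exact: norm_act.
Qed.

Definition orbit_map : bmorphism (regular_module A) X :=
  BMorphism orbit_fun_act orbit_fun_bounded.

End orbit_map.

Section jacobson.
Context (R : realType) (A : banachAlgType R).

Definition left_ideal (I : set A) : Prop :=
  [/\ I 0, forall a b, I a -> I b -> I (a - b)
     & forall a b, I b -> I (bmul a b)].

Definition maximal_left_ideal (I : set A) : Prop :=
  [/\ left_ideal I, I <> setT
     & forall J, left_ideal J -> I `<=` J -> J = I \/ J = setT].

Definition jacobson_radical : set A :=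
  \bigcap_(I in maximal_left_ideal) I.

End jacobson.

Definition linear_span (K : pzRingType) (V : lmodType K) (S : set V) : set V :=
  [set v | exists (n : nat) (c : 'I_n -> K) (s : 'I_n -> V),
     (forall i, S (s i)) /\ v = \sum_(i < n) c i *: s i].

Definition act_span (R : realType) (A : banachAlgType R) (X : banachModType A)
    (I : set A) : set X :=
  linear_span [set act a x | a in I & x in [set: X]].
Arguments act_span {R A} X I.

Section quotient.
Context (R : realType) (A : banachAlgType R) (X : banachModType A).

Definition closed_submodule (Z : set X) : Prop :=
  [/\ closed Z, Z 0, forall (k : R[i]) x y, Z x -> Z y -> Z (k *: x + y)
     & forall (a : A) x, Z x -> Z (act a x)].

Definition submodule_hull (Z : set X) : set X :=
  \bigcap_(W in [set W | closed_submodule W /\ Z `<=` W]) W.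

Lemma submodule_hull_closed (Z : set X) : closed_submodule (submodule_hull Z).
Proof.
split.
- by apply: closed_bigI => W [[]].
- by move=> W [[]].
- by move=> k x y Zx Zy W ZW; have [[_ _ + _] _] := ZW; apply; [exact: (Zx _ ZW)|exact: (Zy _ ZW)].
- by move=> a x Zx W ZW; have [[_ _ _ +] _] := ZW; apply; exact: (Zx _ ZW).
Qed.

Lemma submodule_hull_id (Z : set X) :
  closed_submodule Z -> submodule_hull Z = Z.
Proof.
move=> Zc; apply/seteqP; split=> x; first by move=> /(_ Z); apply; split.
by move=> Zx W [_]; apply.
Qed.

(* bquot Z is the quotient Banach module of X by the closed submodule generated
   by the set Z, that is by Z itself when Z is a closed submodule
   (submodule_hull_id).  The quotient norm is the infimum of the norms of the
   representatives; it is computed in R and injected into R[i], where norms of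
   complex normed modules take their values. *)
Context (Z : set X).
Let H := submodule_hull Z.

Definition hull_pred : X -> bool := fun x => `[< H x >].

Fact hull_pred_zmod_closed : zmod_closed hull_pred.
Proof.
have [_ H0 HP _] := submodule_hull_closed Z.
split=> [|x y]; rewrite !unfold_in; first exact/asboolP.
move=> /asboolP Hx /asboolP Hy; apply/asboolP.
by rewrite addrC -scaleN1r; exact: HP.
Qed.

HB.instance Definition _ := GRing.isZmodClosed.Build X hull_pred
  hull_pred_zmod_closed.

Definition hull_zmod : zmodClosed X := GRing.ZmodClosed.clone X hull_pred _.

Definition bquot : Type := Quotient.quot hull_zmod.

HB.instance Definition _ := GRing.Zmodule.on bquot.

Definition bquot_pi (x : X) : bquot := \pi_(Quotient.quot hull_zmod) x.
Local Notation p := bquot_pi.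

Lemma bquot_piP x y : p x = p y <-> H (x - y).
Proof.
split=> [/eqP|xy]; first by rewrite -Quotient.idealrBE unfold_in => /asboolP.
by apply/eqP; rewrite -Quotient.idealrBE unfold_in; exact/asboolP.
Qed.

Lemma bquot_pi_surj q : exists x, p x = q.
Proof. by exists (repr (q : Quotient.quot hull_zmod)); exact: reprK. Qed.

Lemma bquot_piD x y : p (x + y) = p x + p y.
Proof. exact: Quotient.pi_add. Qed.

Lemma bquot_pi0 : p 0 = 0.
Proof.
have /eqP := bquot_piD 0 0.
by rewrite addr0 -subr_eq subrr eq_sym => /eqP.
Qed.

Definition bquot_scale (k : R[i]) (q : bquot) : bquot :=
  p (k *: repr (q : Quotient.quot hull_zmod)).

Lemma bquot_piZ k x : p (k *: x) = bquot_scale k (p x).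
Proof.
have [_ H0 HP _] := submodule_hull_closed Z.
apply/bquot_piP; rewrite -scalerBr -[_ *: _]addr0; apply: HP => //.
by apply/bquot_piP; rewrite /p reprK.
Qed.

Fact bquot_scaleA a b q :
  bquot_scale a (bquot_scale b q) = bquot_scale (a * b) q.
Proof. by have [x <-] := bquot_pi_surj q; rewrite -!bquot_piZ scalerA. Qed.

Fact bquot_scale1 : left_id 1 bquot_scale.
Proof. by move=> q; have [x <-] := bquot_pi_surj q; rewrite -bquot_piZ scale1r. Qed.

Fact bquot_scaleDr : right_distributive bquot_scale +%R.
Proof.
move=> k q r; have [x <-] := bquot_pi_surj q; have [y <-] := bquot_pi_surj r.
by rewrite -bquot_piD -!bquot_piZ -bquot_piD scalerDr.
Qed.

Fact bquot_scaleDl q : {morph bquot_scale^~ q : a b / a + b}.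
Proof.
by move=> a b; have [x <-] := bquot_pi_surj q; rewrite -!bquot_piZ -bquot_piD scalerDl.
Qed.

HB.instance Definition _ := GRing.Zmodule_isLmodule.Build R[i] bquot
  bquot_scaleA bquot_scale1 bquot_scaleDr bquot_scaleDl.

Fact bquot_pi_linear : linear p.
Proof. by move=> k x y; rewrite bquot_piD bquot_piZ. Qed.

HB.instance Definition _ := GRing.isLinear.Build R[i] X bquot *:%R p
  bquot_pi_linear.

Local Notation nr x := (complex.Re `|x|).

Lemma nrE (V : normedModType R[i]) (x : V) : (nr x)%:C = `|x|.
Proof. by rewrite RRe_real ?ger0_real. Qed.

Definition bquot_rnorm (q : bquot) : R :=
  inf [set nr x | x in [set x | p x = q]].

Lemma ltr0c (r : R) : (0 < r%:C) = (0 < r).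
Proof. exact: ltcR 0 r. Qed.

Lemma nr_ge0 (V : normedModType R[i]) (x : V) : 0 <= nr x.
Proof. by rewrite -ler0c nrE. Qed.

Lemma nrD (V : normedModType R[i]) (x y : V) : nr (x + y) <= nr x + nr y.
Proof. by rewrite -lecR rmorphD/= !nrE ler_normD. Qed.

Lemma ball_nr (V : normedModType R[i]) (x y : V) (r : R) :
  ball x r%:C y = (nr (x - y) < r) :> Prop.
Proof. by rewrite -ball_normE/= -[in LHS]nrE ltcR. Qed.

Lemma bquot_rnorm_has_inf q : has_inf [set nr x | x in [set x | p x = q]].
Proof.
split; first by have [x pq] := bquot_pi_surj q; exists (nr x), x.
by exists 0 => _ [x _ <-]; exact: nr_ge0.
Qed.

Lemma bquot_rnorm_ge0 q : 0 <= bquot_rnorm q.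
Proof.
apply: lb_le_inf; first exact: (bquot_rnorm_has_inf q).1.
by move=> _ [x _ <-]; exact: nr_ge0.
Qed.

Lemma bquot_rnorm_le x : bquot_rnorm (p x) <= nr x.
Proof. by apply: ge_inf; [exact: (bquot_rnorm_has_inf (p x)).2|exists x]. Qed.

Lemma bquot_rnorm_lt q (e : R) : 0 < e ->
  exists x, p x = q /\ nr x < bquot_rnorm q + e.
Proof.
move=> e0; have [_ [x xq <-] xe] := inf_adherent e0 (bquot_rnorm_has_inf q).
by exists x.
Qed.

Definition bquot_norm (q : bquot) : R[i] := (bquot_rnorm q)%:C.

Fact bquot_normD q r : bquot_norm (q + r) <= bquot_norm q + bquot_norm r.
Proof.
rewrite /bquot_norm -rmorphD/= lecR; apply/ler_addgt0Pr => e e0.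
have e20 : 0 < e / 2 by rewrite divr_gt0.
have [x [<- xe]] := bquot_rnorm_lt q e20.
have [y [<- ye]] := bquot_rnorm_lt r e20.
rewrite -bquot_piD (le_trans (bquot_rnorm_le _))// (le_trans (nrD _ _))//.
by rewrite [e]splitr addrACA; apply: lerD; exact: ltW.
Qed.

Let bquot_normZ_le (k : R[i]) q :
  bquot_norm (k *: q) <= `|k| * bquot_norm q.
Proof.
have [->|k0] := eqVneq k 0.
  rewrite scale0r normr0 mul0r -bquot_pi0 /bquot_norm (lecR _ 0).
  by rewrite (le_trans (bquot_rnorm_le _))// normr0.
have kE : (complex.Re `|k|)%:C = `|k| by rewrite RRe_real ?ger0_real.
rewrite -kE /bquot_norm -rmorphM/= lecR.
have nk0 : 0 < complex.Re `|k| by rewrite -ltcR kE normr_gt0.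
rewrite mulrC -ler_pdivrMr//; apply/ler_addgt0Pr => e e0.
have [x [<- xe]] := bquot_rnorm_lt q e0.
rewrite (le_trans _ (ltW xe))// ler_pdivrMr// -linearZ.
rewrite (le_trans (bquot_rnorm_le _))//.
by rewrite -lecR rmorphM/= kE !nrE normrZ mulrC.
Qed.

Fact bquot_normZ (k : R[i]) q : bquot_norm (k *: q) = `|k| * bquot_norm q.
Proof.
apply/eqP; rewrite eq_le bquot_normZ_le/=.
have [->|k0] := eqVneq k 0.
  by rewrite normr0 mul0r ler0c bquot_rnorm_ge0.
rewrite -ler_pdivlMl ?normr_gt0// -normfV.
by rewrite -[q in leLHS]scale1r -(mulVf k0) -scalerA bquot_normZ_le.
Qed.

Fact bquot_norm0_eq0 q : bquot_norm q = 0 -> q = 0.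
Proof.
move=> /complexI q0; have [Hc _ _ _] := submodule_hull_closed Z.
have [x xq] := bquot_pi_surj q; rewrite -xq -bquot_pi0.
apply/bquot_piP; rewrite subr0; apply: Hc => B /nbhs_ballP[e /= e0 xB].
have er : e = (complex.Re e)%:C by rewrite RRe_real ?gtr0_real.
have [|y [yq]] := @bquot_rnorm_lt q (complex.Re e); first by rewrite -ltcR -er.
rewrite q0 add0r => ye; exists (x - y); split.
  by apply/bquot_piP; rewrite xq yq.
by apply: xB; rewrite -ball_normE/= subKr -nrE er ltcR.
Qed.

HB.instance Definition _ := Lmodule_isNormed.Build R[i] bquot
  bquot_normD bquot_normZ bquot_norm0_eq0.

Lemma bquot_rnormE q : nr q = bquot_rnorm q. Proof. by []. Qed.

Fact bquot_complete (F : set_system bquot) :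
  ProperFilter F -> cauchy F -> cvg F.
Proof.
move=> FF /cauchyP Fc.
pose d n : R := (2^-1) ^+ n.
have d0 n : 0 < d n by rewrite exprn_gt0// invr_gt0.
have dS n : d n.+1 = d n / 2 by rewrite /d exprSr.
have dC n : 0 < (d n)%:C by rewrite ltr0c.
have /choice[q qF] : forall n, exists q, F (ball q (d n)%:C).
  by move=> n; exact: Fc (dC n).
have q_dist n : nr (q n.+1 - q n) < d n *+ 2.
  have [r [rn rS]] : (ball (q n) (d n)%:C `&` ball (q n.+1) (d n.+1)%:C) !=set0.
    exact: filter_ex (filterI (qF n) (qF n.+1)).
  move: rn rS; rewrite !ball_nr => rn rS.
  rewrite -[q n.+1](subrK r) -addrA (le_lt_trans (nrD _ _))//.
  rewrite mulr2n; apply: ltr_leD; last by rewrite distrC ltW.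
  by rewrite (lt_trans rS)// dS ltr_pdivrMr// ltr_pMr ?ltr1n.
have /choice[l lP] : forall n, exists x,
    p x = q n.+1 - q n /\ nr x < d n *+ 3.
  move=> n; have [x [px xn]] := bquot_rnorm_lt (q n.+1 - q n) (d0 n).
  exists x; split => //; move: xn (q_dist n); rewrite -bquot_rnormE.
  by set u := complex.Re _; set v := complex.Re _; lra.
have [x0 px0] := bquot_pi_surj (q 0%N).
pose x n := x0 + \sum_(i < n) l i.
have px n : p (x n) = q n.
  elim: n => [|n IH]; first by rewrite /x big_ord0 addr0.
  by rewrite /x big_ord_recr/= addrA bquot_piD IH (lP n).1 addrC subrK.
have x_dist n k : nr (x (n + k)%N - x n) <= (d n - d (n + k)%N) *+ 6.
  elim: k => [|k IH]; first by rewrite addn0 !subrr normr0 mul0rn lexx.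
  rewrite addnS /x big_ord_recr/= addrA -/(x _) addrAC.
  rewrite (le_trans (nrD _ _))// (le_trans (lerD IH (ltW (lP _).2)))//.
  by rewrite dS; lra.
have d_small (e : R) : 0 < e -> exists n, d n < e.
  move=> e0; have /cvgrPdist_lt/(_ e e0)[n _ /(_ n (leqnn _))] :
      d @ \oo --> (0 : R).
    by apply: cvg_expr; rewrite ger0_norm// invf_lt1 ?ltr1n.
  by rewrite sub0r normrN ger0_norm ?(ltW (d0 n))// => dn; exists n.
have eR (e : R[i]) : 0 < e -> exists2 r : R, 0 < r & e = r%:C.
  move=> e0; exists (complex.Re e); last by rewrite RRe_real// gtr0_real.
  by rewrite -ltr0c RRe_real// gtr0_real.
have : cvg (x @ \oo).
  apply: cauchy_cvg; apply: cauchy_exP => _ /eR[e e0 ->].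
  have [|n dn] := d_small (e / 6); first by rewrite divr_gt0.
  exists (x n), n => // m /= nm; rewrite ball_nr distrC.
  rewrite -(subnKC nm) (le_lt_trans (x_dist _ _))//.
  have := d0 (n + (m - n))%N; move: dn; lra.
move=> /cvg_ex[/= y xy]; apply/cvg_ex; exists (p y).
apply/cvg_ballP => _ /eR[e e0 ->].
have [|N dN] := d_small (e / 2); first by rewrite divr_gt0.
have := xy; move=> /cvgrPdist_lt /(_ (e / 2)%:C).
case; first by rewrite ltr0c divr_gt0.
move=> M _ My; pose n := maxn N M.
have dn : d n < e / 2.
  apply: le_lt_trans dN; rewrite /d; apply: ler_wiXn2l; last exact: leq_maxl.
    by rewrite invr_ge0.
  by rewrite invf_le1 ?ler1n.
have /= := My n (leq_maxr _ _); rewrite -nrE ltcR => yn.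
apply: filterS (qF n) => r; rewrite !ball_nr => qr.
rewrite -(subrK (q n) (p y)) -addrA (le_lt_trans (nrD _ _))// [e]splitr.
apply: ltrD; last exact: lt_trans qr dn.
rewrite -px -linearB; exact: le_lt_trans (bquot_rnorm_le _) yn.
Qed.

HB.instance Definition _ := Uniform_isComplete.Build bquot bquot_complete.

Definition bquot_act (a : A) (q : bquot) : bquot :=
  p (act a (repr (q : Quotient.quot hull_zmod))).

Lemma bquot_piA (a : A) x : p (act a x) = bquot_act a (p x).
Proof.
have [_ _ _ HA] := submodule_hull_closed Z.
apply/bquot_piP; set y := repr _; suff -> : act a x - act a y = act a (x - y).
  by apply: HA; apply/bquot_piP; rewrite /y /p reprK.
by rewrite -scaleN1r addrC -actPr scaleN1r addrC.
Qed.

Fact bquot_actPl (k : R[i]) (a b : A) q :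
  bquot_act (k *: a + b) q = k *: bquot_act a q + bquot_act b q.
Proof.
by have [x <-] := bquot_pi_surj q; rewrite -!bquot_piA actPl linearP.
Qed.

Fact bquot_actPr (k : R[i]) (a : A) q r :
  bquot_act a (k *: q + r) = k *: bquot_act a q + bquot_act a r.
Proof.
have [x <-] := bquot_pi_surj q; have [y <-] := bquot_pi_surj r.
by rewrite -linearP -!bquot_piA actPr linearP.
Qed.

Fact bquot_actM (a b : A) q :
  bquot_act (bmul a b) q = bquot_act a (bquot_act b q).
Proof. by have [x <-] := bquot_pi_surj q; rewrite -!bquot_piA actM. Qed.

Fact bquot_norm_act (a : A) q : `|bquot_act a q| <= `|a| * `|q|.
Proof.
rewrite -[leLHS]nrE -(nrE a) -(nrE q) -rmorphM/= lecR.
apply/ler_addgt0Pr => e e0; have a0 := nr_ge0 a.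
have a1 : 0 < nr a + 1 by rewrite ltr_wpDl.
have [|x [<- xe]] := @bquot_rnorm_lt q (e / (nr a + 1)).
  by rewrite divr_gt0.
rewrite -bquot_piA (le_trans (bquot_rnorm_le _))//.
apply: (@le_trans _ _ (nr a * nr x)).
  by rewrite -lecR rmorphM/= !nrE norm_act.
rewrite (le_trans (ler_wpM2l a0 (ltW xe)))// mulrDr lerD2l.
by rewrite mulrCA ger_pMr// ler_pdivrMr// mul1r lerDl.
Qed.

HB.instance Definition _ := isBanachModule.Build R A bquot
  bquot_actPl bquot_actPr bquot_actM bquot_norm_act.

Lemma bquot_pi_eq0 x : closed_submodule Z -> p x = 0 <-> Z x.
Proof.
by move=> Zc; rewrite -bquot_pi0 bquot_piP /H submodule_hull_id// subr0.
Qed.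

End quotient.

(* Main.v *)
(* A point x lies in trad X exactly when its orbit map A -> X is small, and
   smallness only depends on the image of a morphism; so everything is about
   submodules Im phi with Im phi + A x = X.

   Functoriality: a morphism chi with Im chi + Im (phi psi) = Y pulls back along
   phi to a morphism with image phi^-1 (Im chi), and Im psi together with this
   image spans X; smallness of psi gives Im phi <= Im chi, so chi is surjective.

   Closedness: if Im phi + A x = X, then (y, a) |-> phi y + a x is a surjection of
   Banach spaces, and it remains one when x is replaced by a nearby x' in trad X
   (Baire category and successive approximation), so that Im phi + A x' = X and
   phi is surjective.

   Jacobson radical: if phi : Y -> A is not surjective, the left ideal Im phi lies
   in a maximal left ideal, which contains r, so Im phi + A r is proper; hence r
   is in the radical of the module A, and r x is its image under the orbit map
   of x. *)
From HB Require Import structures.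
Require Import Defs.
From mathcomp Require Import all_boot all_order all_algebra.
From mathcomp Require Import complex ring lra.
From mathcomp Require Import all_classical all_reals all_analysis.

Import Order.TTheory GRing.Theory Num.Theory.
Import numFieldNormedType.Exports.

Set Implicit Arguments.
Unset Strict Implicit.
Unset Printing Implicit Defensive.

Local Open Scope classical_set_scope.
Local Open Scope ring_scope.
Local Open Scope complex_scope.

Local Notation nr x := (complex.Re `|x|).

(** * Real-valued norms, geometric convergence, Baire category and successive approximation *)

Section real_norm.
Context {R : realType}.
Implicit Types V : normedModType R[i].

Lemma nr0 V : nr (0 : V) = 0.
Proof. by rewrite normr0. Qed.

Lemma nr_dist V (x y : V) : nr (x - y) = nr (y - x).
Proof. by rewrite distrC. Qed.

Lemma nrZ V (r : R) (x : V) : 0 <= r -> nr (r%:C *: x) = r * nr x.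
Proof.
move=> r0; apply: (@complexI R); rewrite nrE rmorphM/= nrE normrZ.
by rewrite ger0_norm// ler0c.
Qed.

Lemma nr_triangle V (z x y : V) : nr (x - y) <= nr (x - z) + nr (z - y).
Proof. by rewrite -[x - y](subrKA z) nrD. Qed.

Lemma nr_eq0P V (x : V) : nr x = 0 -> x = 0.
Proof. by move=> x0; apply: normr0_eq0; rewrite -nrE x0. Qed.

Lemma gt0_realC (e : R[i]) : 0 < e -> exists2 r : R, 0 < r & e = r%:C.
Proof.
move=> e0; exists (complex.Re e); last by rewrite RRe_real// gtr0_real.
by rewrite -ltr0c RRe_real// gtr0_real.
Qed.

Lemma closureP_nr V (S : set V) (x : V) :
  closure S x <-> forall e : R, 0 < e -> exists2 y, S y & nr (x - y) < e.
Proof.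
split=> [Sx e e0|Sx B /nbhs_ballP[_ /= /gt0_realC[e e0 ->] xB]].
  have /Sx[y [Sy]] : nbhs x (ball x e%:C) by apply: nbhsx_ballx; rewrite ltr0c.
  by rewrite ball_nr; exists y.
by have [y Sy xy] := Sx e e0; exists y; split => //; apply: xB; rewrite ball_nr.
Qed.

Lemma exp2V_small (C e : R) : 0 < e -> exists n, C * 2^-1 ^+ n < e.
Proof.
move=> e0; have C0 : 0 < `|C| + 1 by rewrite ltr_wpDl.
have /cvgrPdist_lt/(_ (e / (`|C| + 1)))[|n _ /(_ n (leqnn _))] :
    (fun n => 2^-1 ^+ n : R) @ \oo --> (0 : R).
- by apply: cvg_expr; rewrite ger0_norm// invf_lt1 ?ltr1n.
- by rewrite divr_gt0.
have d0 : 0 <= (2^-1 : R) ^+ n by rewrite exprn_ge0.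
rewrite sub0r normrN ger0_norm// ltr_pdivlMr// => dn; exists n.
rewrite (le_lt_trans _ dn)// mulrC ler_wpM2l//.
by rewrite (le_trans (ler_norm _))// lerDl.
Qed.

(** Telescoping the steps gives a Cauchy sequence; the factor 2 is the sum [1 + 1/2 + 1/4 + ...] of
    the geometric tail. *)
Lemma geometric_limit (V : completeNormedModType R[i]) (x : nat -> V) (C : R) :
  (forall n, nr (x n.+1 - x n) <= C * 2^-1 ^+ n) ->
  exists l, forall n, nr (l - x n) <= C *+ 2 * 2^-1 ^+ n.
Proof.
move=> xC; pose d n : R := 2^-1 ^+ n.
have d0 n : 0 < d n by rewrite exprn_gt0// invr_gt0.
have dS n : d n.+1 = d n / 2 by rewrite /d exprSr.
have C0 : 0 <= C.
  by have := le_trans (nr_ge0 _) (xC 0%N); rewrite expr0 mulr1.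
have x_dist n k : nr (x (n + k)%N - x n) <= C *+ 2 * (d n - d (n + k)%N).
  elim: k => [|k IH]; first by rewrite addn0 !subrr nr0 mulr0.
  have := nr_triangle (x (n + k)%N) (x (n + k).+1) (x n).
  rewrite addnS dS; have := xC (n + k)%N; rewrite -/(d _); move: IH; nra.
have x_distW n m : (n <= m)%N -> nr (x m - x n) <= C *+ 2 * d n.
  move=> nm; have := x_dist n (m - n)%N; rewrite subnKC// => /le_trans; apply.
  by rewrite ler_wpM2l// ?mulrn_wge0// gerBl ltW.
have : cvg (x @ \oo).
  apply: cauchy_cvg; apply: cauchy_exP => _ /gt0_realC[e e0 ->].
  have [n dn] := exp2V_small (C *+ 2) e0.
  exists (x n), n => // m /= nm; rewrite ball_nr nr_dist.
  by rewrite (le_lt_trans (x_distW _ _ nm)).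
move=> /cvg_ex[/= l xl]; exists l => n.
apply/ler_addgt0Pr => e e0.
have /cvgrPdist_lt /(_ e%:C) := xl; case; first by rewrite ltr0c.
move=> M _ Ml; pose m := maxn n M.
have /= := Ml m (leq_maxr _ _); rewrite -nrE ltcR => lm.
have := nr_triangle (x m) l (x n); have := x_distW n m (leq_maxl _ _).
by rewrite -/(d n); move: lm; lra.
Qed.

(* The library's Baire theorem is restricted to real scalars, and hence does not
   apply to normed modules over R[i]. *)
Lemma baire_cover (V : completeNormedModType R[i]) (F : nat -> set V) :
  (forall x, exists n, F n x) ->
  exists n x (r : R), 0 < r /\ forall y, nr (y - x) <= r -> closure (F n) y.
Proof.
move=> Fcov; apply: contrapT => nF.
(* As no [closure (F n)] contains a ball, every ball of positive radius contains a smaller one that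
   misses [F n]; other radii get the dummy value [(0, 0)]. *)
have step (a : nat * (V * R)) : exists b : V * R, 0 < a.2.2 ->
    [/\ 0 < b.2, b.2 <= a.2.2 / 2, nr (b.1 - a.2.1) <= a.2.2 / 2
      & forall z, nr (z - b.1) <= b.2 -> ~ F a.1 z].
  case: a => n [x r] /=; have [r0|r0] := ltP 0 r; last first.
    by exists (0, 0).
  have [y [yx nFy]] : exists y, nr (y - x) <= r / 2 /\ ~ closure (F n) y.
    apply: contrapT => nex; apply: nF; exists n, x, (r / 2); split.
      by rewrite divr_gt0.
    by move=> y yx; apply: contrapT => Fy; apply: nex; exists y.
  have [e [e0 eF]] : exists e : R, 0 < e /\ forall z, F n z -> e <= nr (y - z).
    apply: contrapT => nex; apply: nFy; apply/closureP_nr => e e0.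
    apply: contrapT => nz; apply: nex; exists e; split=> // z Fz.
    by rewrite leNgt; apply/negP => yz; apply: nz; exists z.
  exists (y, Num.min (r / 2) (e / 2)) => /= _; split=> //.
  - by rewrite lt_min !divr_gt0.
  - by rewrite ge_min lexx.
  - move=> z; rewrite nr_dist le_min => /andP[_ yz] /eF; move: yz.
    by lra.
have [g gP] := choice step.
pose fix a n := if n is m.+1 then g (m, a m) else (0 : V, 1 : R).
have r0 n : 0 < (a n).2.
  by elim: n => [|n IH] /=; [exact: ltr01|have [] := gP (n, a n) IH].
have aP n := gP (n, a n) (r0 n).
have rS n : (a n.+1).2 <= (a n).2 / 2 by have [] := aP n.
have rexp n : (a n).2 <= 2^-1 ^+ n.
  elim: n => [|n IH]; first by rewrite expr0.
  by rewrite (le_trans (rS n))// exprSr ler_wpM2r.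
have [|l lP] := @geometric_limit V (fun n => (a n).1) 1.
  move=> n; rewrite mul1r; have [_ _ + _] := aP n.
  move=> /le_trans; apply; rewrite (le_trans _ (rexp n))//.
  by have := r0 n; lra.
(* The balls are nested: centres move by no more than the radii shrink, so the limit [l] lies in
   every ball. *)
have adist n k : nr ((a (n + k)%N).1 - (a n).1) <= (a n).2 - (a (n + k)%N).2.
  elim: k => [|k IH]; first by rewrite addn0 !subrr nr0.
  rewrite addnS; have := nr_triangle (a (n + k)%N).1 (a (n + k).+1).1 (a n).1.
  by have [_ + + _] := aP (n + k)%N; move: IH => /=; lra.
have ladist n : nr (l - (a n).1) <= (a n).2.
  apply/ler_addgt0Pr => e e0; have [k ke] := exp2V_small 2 e0.
  have := lP (n + k)%N; have := adist n k; have := r0 (n + k)%N.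
  have := nr_triangle (a (n + k)%N).1 l (a n).1.
  have : 2^-1 ^+ (n + k) <= 2^-1 ^+ k :> R.
    apply: ler_wiXn2l; [by rewrite invr_ge0|by rewrite invf_le1 ?ler1n|].
    exact: leq_addl.
  by move: ke; lra.
have [n Fnl] := Fcov l; have [_ _ _ /(_ l)] := aP n; apply => //.
exact: ladist n.+1.
Qed.

(** The approximate half of the open mapping theorem: by [baire_cover] the closure of the image of
    some ball contains a ball, which differences recentre at 0. The ratio [1 / 4] leaves room for
    the perturbation in [trad_closed]. *)
Lemma approx_preimage (E : normedModType R[i]) (V : completeNormedModType R[i])
    (T : {linear E -> V}) : (forall f, exists e, T e = f) ->
  exists C : R, 0 < C /\
    forall f, exists e, nr e <= C * nr f /\ nr (f - T e) <= nr f / 4.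
Proof.
move=> Tsurj.
have [|n [x [r [r0 xr]]]] := @baire_cover V
    (fun n => [set T e | e in [set e | nr e <= n%:R]]).
  move=> f; have [e <-] := Tsurj f; exists (Num.truncn (nr e)).+1, e => //=.
  by rewrite ltW// truncnS_gt.
have approx f : nr f <= r ->
    exists e, nr e <= n%:R *+ 2 /\ nr (f - T e) <= r / 4.
  (* Both [f + x] and [x] are approximated within [r / 8], so the difference approximates [f] within
     [r / 4]. *)
  move=> fr; have r8 : 0 < r / 8 by rewrite divr_gt0.
  have := xr (f + x); rewrite addrK => /(_ fr)/closureP_nr/(_ _ r8).
  move=> [_ [e1 /= e1n <-] fe1].
  have := xr x; rewrite subrr nr0 => /(_ (ltW r0))/closureP_nr/(_ _ r8).
  move=> [_ [e2 /= e2n <-] fe2].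
  exists (e1 - e2); split.
    have := nrD e1 (- e2); rewrite normrN; move: e1n e2n.
    by lra.
  have -> : f - T (e1 - e2) = (f + x - T e1) - (x - T e2).
    by rewrite linearB/= !opprB ![T e2 + _]addrC !addrA [_ - T e1 - x]addrAC addrK.
  have := nrD (f + x - T e1) (- (x - T e2)); rewrite normrN.
  by move: fe1 fe2; lra.
(* Scaling [f] to norm [r] and back turns the bound [n%:R *+ 2] into the factor [n%:R *+ 2 / r];
   adding 1 keeps it positive for [n = 0]. *)
exists (n%:R *+ 2 / r + 1); split.
  by rewrite ltr_wpDl// divr_ge0 ?mulrn_wge0// ltW.
move=> f; have [f0|f0] := eqVneq (nr f) 0.
  exists 0; rewrite nr0 linear0 subr0 f0 mulr0 mul0r; split => //.
have {}f0 : 0 < nr f by rewrite lt_def f0 nr_ge0.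
pose l := r / nr f; have l0 : 0 < l by rewrite divr_gt0.
have li0 : 0 <= l^-1 by rewrite invr_ge0 ltW.
have [|e [en fe]] := approx (l%:C *: f).
  by rewrite (nrZ _ (ltW l0)) divfK ?gt_eqF.
have lE : l^-1 = nr f / r by rewrite invf_div.
exists (l^-1%:C *: e); rewrite nrZ//; split.
  rewrite mulrDl mul1r (@le_trans _ _ (l^-1 * (n%:R *+ 2)))//.
    by rewrite ler_wpM2l.
  by rewrite lE mulrC mulrCA mulrC [_ / r * _]mulrC mulrA lerDl ltW.
have -> : f - T (l^-1%:C *: e) = l^-1%:C *: (l%:C *: f - T e).
  rewrite linearZ/= scalerBr scalerA -rmorphM/= mulVf ?gt_eqF//.
  by rewrite scale1r.
rewrite nrZ// (le_trans (ler_wpM2l li0 fe))// lE.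
by rewrite mulrA divfK// gt_eqF.
Qed.

(** Each correction at least halves the residual, so the corrections form a convergent series, whose
    sum is an exact preimage because [T] is bounded. *)
Lemma approx_surj (E : completeNormedModType R[i]) (V : normedModType R[i])
    (T : {linear E -> V}) (M C : R) :
  (forall e, nr (T e) <= M * nr e) ->
  (forall f, exists e, nr e <= C * nr f /\ nr (f - T e) <= nr f / 2) ->
  forall f, exists e, T e = f.
Proof.
move=> TM /choice[g gP] f.
(* [u n] is the residual after [n] corrections, [e n] the sum of these corrections. *)
pose fix u n := if n is m.+1 then u m - T (g (u m)) else f.
pose e n := \sum_(i < n) g (u i).
have un n : nr (u n) <= nr f * 2^-1 ^+ n.
  elim: n => [|n IH]; first by rewrite expr0 mulr1.
  by have [_ /=] := gP (u n); rewrite exprSr; move: IH; lra.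
have Te n : T (e n) = f - u n.
  elim: n => [|n IH]; first by rewrite /e big_ord0 linear0 subrr.
  by rewrite /e big_ord_recr/= linearD/= IH opprB addrA addrAC.
have [|l lP] := @geometric_limit E e (`|C| * nr f).
  move=> n; rewrite /e big_ord_recr/= addrAC subrr add0r.
  have [gu _] := gP (u n); rewrite (le_trans gu)//.
  rewrite (@le_trans _ _ (`|C| * nr (u n)))//.
    by rewrite ler_wpM2r ?nr_ge0// ler_norm.
  by rewrite -mulrA ler_wpM2l.
exists l; apply/esym/eqP; rewrite -subr_eq0; apply/eqP/nr_eq0P/eqP.
rewrite eq_le nr_ge0 andbT; apply/ler_addgt0Pr => d d0; rewrite add0r.
have [n nd] := exp2V_small (nr f + `|M| * (`|C| * nr f *+ 2)) d0.
rewrite (le_trans _ (ltW nd))// (le_trans (nr_triangle (T (e n)) _ _))//.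
rewrite mulrDl; apply: lerD; first by rewrite Te subKr.
rewrite -linearB/= (le_trans (TM _))//.
rewrite (@le_trans _ _ (`|M| * nr (e n - l)))//.
  by rewrite ler_wpM2r ?nr_ge0// ler_norm.
by rewrite -mulrA ler_wpM2l// nr_dist.
Qed.

End real_norm.

(** * Products of Banach modules *)

Section complete_prod.
Context {K : numFieldType} {U V : completeNormedModType K}.

(* Makes HB infer the join of the pointed and uniform structures on products,
   which completeness requires. *)
HB.instance Definition _ := Pointed.on (U * V)%type.

Fact prod_complete (F : set_system (U * V)%type) :
  ProperFilter F -> cauchy F -> cvg F.
Proof.
move=> FF /cauchyP Fc.
have c1 : cvg (fst @ F).
  apply: cauchy_cvg; apply/cauchyP => e e0; have [q qF] := Fc _ e0.
  by exists q.1; apply: (@filterS _ F _ _ _ _ qF) => x [].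
have c2 : cvg (snd @ F).
  apply: cauchy_cvg; apply/cauchyP => e e0; have [q qF] := Fc _ e0.
  by exists q.2; apply: (@filterS _ F _ _ _ _ qF) => x [].
move: c1 c2 => /cvg_ex[/= l1 /cvg_ballP l1P] /cvg_ex[/= l2 /cvg_ballP l2P].
apply/cvg_ex; exists (l1, l2); apply/cvg_ballP => e e0.
by apply: filterS (filterI (l1P _ e0) (l2P _ e0)) => x [].
Qed.

HB.instance Definition _ := Uniform_isComplete.Build (U * V)%type prod_complete.

End complete_prod.

Section product_module.
Context {R : realType} {A : banachAlgType R} {U V : banachModType A}.

Definition prod_act (a : A) (x : U * V) : U * V := (act a x.1, act a x.2).

Fact prod_actPl (k : R[i]) (a b : A) (x : U * V) :
  prod_act (k *: a + b) x = k *: prod_act a x + prod_act b x.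
Proof. by rewrite /prod_act !actPl. Qed.

Fact prod_actPr (k : R[i]) (a : A) (x y : U * V) :
  prod_act a (k *: x + y) = k *: prod_act a x + prod_act a y.
Proof. by rewrite /prod_act !actPr. Qed.

Fact prod_actM (a b : A) (x : U * V) :
  prod_act (bmul a b) x = prod_act a (prod_act b x).
Proof. by rewrite /prod_act !actM. Qed.

Fact prod_norm_act (a : A) (x : U * V) : `|prod_act a x| <= `|a| * `|x|.
Proof.
(* The order of [R[i]] is partial; the maximum is handled through the comparability of norms, which
   are real elements. *)
rewrite !prod_normE/= maxr_pMr// comparable_ge_max.
  by rewrite !comparable_le_max ?real_comparable// !norm_act ?orbT.
by rewrite real_comparable.
Qed.

HB.instance Definition _ := isBanachModule.Build R A (U * V)%type
  prod_actPl prod_actPr prod_actM prod_norm_act.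

End product_module.

(** * Morphisms: composition, copairing and projection *)

Section morphisms.
Context {R : realType} {A : banachAlgType R}.

Lemma act0r (X : banachModType A) (a : A) : act a (0 : X) = 0.
Proof.
have := actPr 1 a (0 : X) 0; rewrite scaler0 addr0 scale1r => /eqP.
by rewrite -subr_eq subrr eq_sym => /eqP.
Qed.

Lemma bmor_nr (X Y : banachModType A) (phi : bmorphism X Y) :
  exists M : R, 0 <= M /\ forall x, nr (phi x) <= M * nr x.
Proof.
have [M phiM] := bmor_bounded phi; exists `|M|; split=> // x.
rewrite (@le_trans _ _ (M * nr x))//.
  by rewrite -lecR rmorphM/= !nrE.
by rewrite ler_wpM2r ?nr_ge0// ler_norm.
Qed.

Section comp.
Context {X Y Z : banachModType A}.
Variables (psi : bmorphism Y Z) (phi : bmorphism X Y).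

Fact bcomp_act a x : (psi \o phi) (act a x) = act a ((psi \o phi) x).
Proof. by rewrite /= !bmor_act. Qed.

Fact bcomp_bounded : exists M : R, forall x, `|(psi \o phi) x| <= M%:C * `|x|.
Proof.
have [M [M0 psiM]] := bmor_nr psi; have [N [N0 phiN]] := bmor_nr phi.
exists (M * N) => x; rewrite -[leLHS]nrE -(nrE x) -rmorphM/= lecR (le_trans (psiM _))//.
by rewrite -mulrA ler_wpM2l.
Qed.

Definition bcomp : bmorphism X Z := BMorphism bcomp_act bcomp_bounded.

End comp.

Section copair.
Context {X Y Z : banachModType A}.
Variables (phi : bmorphism X Z) (psi : bmorphism Y Z).

(** Turns a sum of two images into one image, so that covering [Z] becomes surjectivity of a single
    morphism. *)
Definition copair_fun (p : X * Y) : Z := phi p.1 + psi p.2.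

Fact copair_linear : linear copair_fun.
Proof.
by move=> k p q; rewrite /copair_fun !linearP scalerDr addrACA.
Qed.

HB.instance Definition _ := GRing.isLinear.Build R[i] (X * Y)%type Z *:%R
  copair_fun copair_linear.

Fact copair_act a p : copair_fun (act a p) = act a (copair_fun p).
Proof.
rewrite /copair_fun !bmor_act -[X in _ = act a (X + _)]scale1r actPr.
by rewrite scale1r.
Qed.

Lemma nr_prod (p : X * Y) : nr p.1 <= nr p /\ nr p.2 <= nr p.
Proof.
rewrite -!lecR !nrE prod_normE.
by rewrite !comparable_le_max ?real_comparable// !lexx orbT.
Qed.

Fact copair_bounded : exists M : R, forall p, `|copair_fun p| <= M%:C * `|p|.
Proof.
have [M [M0 phiM]] := bmor_nr phi; have [N [N0 psiN]] := bmor_nr psi.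
exists (M + N) => p; rewrite -[leLHS]nrE -(nrE p) -rmorphM/= lecR (le_trans (nrD _ _))//.
have [p1 p2] := nr_prod p; rewrite mulrDl; apply: lerD.
  by rewrite (le_trans (phiM _))// ler_wpM2l.
by rewrite (le_trans (psiN _))// ler_wpM2l.
Qed.

Definition copair : bmorphism (X * Y)%type Z :=
  BMorphism copair_act copair_bounded.

End copair.

Section snd.
Context (X Y : banachModType A).

Fact snd_act (a : A) (p : X * Y) : (act a p).2 = act a p.2.
Proof. by []. Qed.

Fact snd_bounded : exists M : R, forall p : X * Y, `|p.2| <= M%:C * `|p|.
Proof.
exists 1 => p; rewrite mul1r -[leLHS]nrE -(nrE p) lecR; exact: (nr_prod p).2.
Qed.

Definition bsnd : bmorphism (X * Y)%type Y :=
  @BMorphism _ _ (X * Y)%type Y snd snd_act snd_bounded.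

End snd.
End morphisms.

(** * Kernels as Banach modules, used for pullbacks *)

Section kernel.
Context {R : realType} {A : banachAlgType R} {X Y : banachModType A}.
Variable f : bmorphism X Y.

Definition ker_pred : {pred X} := fun x => f x == 0.

Fact ker_submod_closed : submod_closed ker_pred.
Proof.
split=> [|k x y]; rewrite !unfold_in ?linear0// linearP.
by move=> /eqP -> /eqP ->; rewrite scaler0 addr0.
Qed.

HB.instance Definition _ := GRing.isSubmodClosed.Build R[i] X ker_pred
  ker_submod_closed.

Record bker : Type := BKer { bker_val : X; bker_valP : bker_val \in ker_pred }.

HB.instance Definition _ := [isSub for bker_val].
HB.instance Definition _ := [Choice of bker by <:].
HB.instance Definition _ := [SubChoice_isSubLmodule of bker by <:].

Fact bker_normD (x y : bker) :
  `|bker_val (x + y)| <= `|bker_val x| + `|bker_val y|.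
Proof. exact: ler_normD. Qed.

Fact bker_normZ (k : R[i]) (x : bker) :
  `|bker_val (k *: x)| = `|k| * `|bker_val x|.
Proof. exact: normrZ. Qed.

Fact bker_norm0_eq0 (x : bker) : `|bker_val x| = 0 -> x = 0.
Proof. by move=> /normr0_eq0 x0; apply/val_inj. Qed.

HB.instance Definition _ := Lmodule_isNormed.Build R[i] bker
  bker_normD bker_normZ bker_norm0_eq0.

Fact bker_complete (F : set_system bker) :
  ProperFilter F -> cauchy F -> cvg F.
Proof.
move=> FF /cauchyP Fc.
have : cvg (bker_val @ F).
  apply: cauchy_cvg; apply/cauchyP => _ /gt0_realC[e e0 ->].
  have [|q qF] := Fc e%:C; first by rewrite ltr0c.
  by exists (bker_val q); apply: (@filterS _ F _ _ _ _ qF) => x; rewrite /= !ball_nr.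
move=> /cvg_ex[/= l /cvg_ballP lF].
(* The limit stays in the kernel because [f] is bounded; dividing by [M + 1] covers the case
   [M = 0]. *)
have kl : l \in ker_pred.
  rewrite unfold_in; have [M [M0 fM]] := bmor_nr f.
  apply/eqP/nr_eq0P/eqP; rewrite eq_le nr_ge0 andbT.
  apply/ler_addgt0Pr => e e0; rewrite add0r.
  have M1 : 0 < M + 1 by rewrite ltr_wpDl.
  have /lF/filter_ex[[x /= /eqP fx]] : 0 < (e / (M + 1))%:C.
    by rewrite ltr0c divr_gt0.
  rewrite ball_nr ltr_pdivlMr// => lx.
  rewrite -[f l]subr0 -fx -linearB/= (le_trans (fM _))//.
  by rewrite (le_trans _ (ltW lx))// mulrC ler_wpM2l ?nr_ge0// lerDl.
apply/cvg_ex; exists (BKer kl); apply/cvg_ballP => _ /gt0_realC[e e0 ->].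
have /lF : 0 < e%:C by rewrite ltr0c.
by move=> lFe; apply: (@filterS _ F _ _ _ _ lFe) => x; rewrite /= !ball_nr.
Qed.

HB.instance Definition _ := Uniform_isComplete.Build bker bker_complete.

Fact bker_act_subproof (a : A) (x : bker) : act a (bker_val x) \in ker_pred.
Proof.
case: x => x /= /eqP fx; by rewrite unfold_in bmor_act fx act0r.
Qed.

Definition bker_act (a : A) (x : bker) : bker := BKer (bker_act_subproof a x).

Fact bker_actPl (k : R[i]) (a b : A) (x : bker) :
  bker_act (k *: a + b) x = k *: bker_act a x + bker_act b x.
Proof. by apply: val_inj; rewrite /= actPl. Qed.

Fact bker_actPr (k : R[i]) (a : A) (x y : bker) :
  bker_act a (k *: x + y) = k *: bker_act a x + bker_act a y.
Proof. by apply: val_inj; rewrite /= actPr. Qed.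

Fact bker_actM (a b : A) (x : bker) :
  bker_act (bmul a b) x = bker_act a (bker_act b x).
Proof. by apply: val_inj; rewrite /= actM. Qed.

Fact bker_norm_act (a : A) (x : bker) : `|bker_act a x| <= `|a| * `|x|.
Proof. exact: norm_act. Qed.

HB.instance Definition _ := isBanachModule.Build R A bker
  bker_actPl bker_actPr bker_actM bker_norm_act.

Fact bker_val_linear : linear bker_val.
Proof. by []. Qed.

HB.instance Definition _ := GRing.isLinear.Build R[i] bker X *:%R bker_val
  bker_val_linear.

Fact bker_val_act (a : A) (x : bker) : bker_val (act a x) = act a (bker_val x).
Proof. by []. Qed.

Fact bker_val_bounded :
  exists M : R, forall x : bker, `|bker_val x| <= M%:C * `|x|.
Proof. by exists 1 => x; rewrite mul1r. Qed.

Definition bker_incl : bmorphism bker X :=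
  BMorphism bker_val_act bker_val_bounded.

End kernel.

(** * Small morphisms: comparison of images, sums and composition *)

Section small_morphisms.
Context {R : realType} {A : banachAlgType R}.
Implicit Types X Y Z : banachModType A.

Lemma actBr X (a : A) (x y : X) : act a (x - y) = act a x - act a y.
Proof. by rewrite addrC -scaleN1r actPr scaleN1r addrC. Qed.

Lemma range_copair X Y Z (phi : bmorphism X Z) (psi : bmorphism Y Z) :
  range (copair phi psi) = [set u + v | u in range phi & v in range psi].
Proof.
apply/seteqP; split=> [_ [[x y] _ <-]|_ [_ [x _ <-]] [_ [y _ <-]] <-].
  by exists (phi x); [exists x|exists (psi y); [exists y|]].
by exists (x, y).
Qed.

Lemma copair_surjP X Y Z (phi : bmorphism X Z) (psi : bmorphism Y Z) :
  [set u + v | u in range phi & v in range psi] = setT <->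
  forall z, exists x y, phi x + psi y = z.
Proof.
rewrite -range_copair; split=> [T z|T].
  have : range (copair phi psi) z by rewrite T.
  by move=> [[x y] _ <-]; exists x, y.
by rewrite -subTset => z _; have [x [y <-]] := T z; exists (x, y).
Qed.

Lemma smallP X Y (psi : bmorphism X Y) : small psi <->
  forall Z (phi : bmorphism Z Y), (forall y, exists z x, phi z + psi x = y) ->
    range phi = setT.
Proof.
by split=> sm Z phi phiT; apply: sm => //; apply/copair_surjP.
Qed.

Lemma small_sub X X' Y (psi : bmorphism X Y) (psi' : bmorphism X' Y) :
  small psi -> range psi' `<=` range psi -> small psi'.
Proof.
move=> /smallP sm sub; apply/smallP => Z phi phiT; apply: sm => y.
have [z [x' <-]] := phiT y.
by have [x _ <-] := sub (psi' x') (ex_intro2 _ _ x' I erefl); exists z, x.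
Qed.

(** Absorb [psi] into [phi] first: smallness of [psi'] makes [copair phi psi] surjective, and
    smallness of [psi] then makes [phi] surjective. *)
Lemma small_copair X X' Y (psi : bmorphism X Y) (psi' : bmorphism X' Y) :
  small psi -> small psi' -> small (copair psi psi').
Proof.
move=> /smallP sm /smallP sm'; apply/smallP => Z phi phiT.
apply: sm => y; have : range (copair phi psi) = setT.
  apply: sm' => {}y; have [z [[x x'] <-]] := phiT y.
  by exists (z, x), x'; rewrite /= /copair_fun addrA.
by move=> /seteqP[_ /(_ y I)] [[z x] _ <-]; exists z, x.
Qed.

(* The pullback of chi and phi, as the kernel of (w, x) |-> chi w + phi x: this
   avoids the opposite of a morphism at the price of a sign on w. *)
Lemma preimage_range X Y W (chi : bmorphism W Y) (phi : bmorphism X Y) :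
  exists (P : banachModType A) (pi : bmorphism P X),
    range pi = phi @^-1` range chi.
Proof.
exists (bker (copair chi phi)), (bcomp (bsnd W X) (bker_incl (copair chi phi))).
apply/seteqP; split=> [_ [[[w x] /eqP k] _ <-]|x [w _ chiw]] /=.
  by exists (- w) => //; rewrite linearN/=; apply/esym/eqP; rewrite -addr_eq0 addrC; exact/eqP.
have k : (- w, x) \in ker_pred (copair chi phi).
  by rewrite unfold_in /= /copair_fun /= linearN/= chiw addNr.
by exists (BKer k).
Qed.

Lemma small_comp X Y Z (phi : bmorphism Y Z) (psi : bmorphism X Y) :
  small psi -> small (bcomp phi psi).
Proof.
move=> /smallP sm; apply/smallP => W chi chiT.
have [P [pi piE]] := preimage_range chi phi.
have piT : range pi = setT.
  (* From [phi y = chi w + phi (psi x)], the element [y - psi x] lies in the preimage of the range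
     of [chi]. *)
  apply: sm => y; have [w [x wx]] := chiT (phi y).
  have : range pi (y - psi x).
    by rewrite piE /=; exists w => //; rewrite linearB/= -wx addrK.
  by move=> [p _ pE]; exists p, x; rewrite pE subrK.
(* As [pi] is onto, [phi (psi x)] is itself some [chi w'], hence [z = chi (w + w')]. *)
rewrite -subTset => z _; have [w [x <-]] := chiT z.
have : range pi (psi x) by rewrite piT.
by rewrite piE => -[w' _ w'x]; exists (w + w') => //; rewrite linearD/= w'x.
Qed.

End small_morphisms.

(** * The topological radical as a closed submodule *)

Section radical.
Context {R : realType} {A : banachAlgType R}.
Implicit Types X Y Z : banachModType A.

Lemma trad_map X Y (phi : bmorphism X Y) (x : X) : trad X x -> trad Y (phi x).
Proof.
move=> [W [psi [sm [w _ <-]]]]; exists W, (bcomp phi psi); split.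
  exact: small_comp.
by exists w.
Qed.

(** The range of [psi] is a submodule, so it contains the whole orbit of [psi w]. *)
Lemma orbit_sub_trad X (x : X) : trad X x -> small (orbit_map x).
Proof.
move=> [W [psi [sm [w _ <-]]]]; apply: (small_sub sm) => _ [a _ <-].
by exists (act (a : A) w) => //; rewrite bmor_act.
Qed.

(** Unitality puts [x], the value at [bone], in the range of its own orbit map. *)
Lemma small_orbitP X (x : X) : unital_module X ->
  small (orbit_map x) <-> trad X x.
Proof.
move=> uX; split; last exact: orbit_sub_trad.
move=> sm; exists (regular_module A), (orbit_map x); split=> //.
by exists (bone : A) => //; exact: uX.
Qed.

Lemma trad0 X : trad X 0.
Proof.
exists (regular_module A), (orbit_map 0); split; last first.
  by exists 0 => //; rewrite linear0.
apply/smallP => Z phi phiT; rewrite -subTset => x _.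
have [z [a <-]] := phiT x; exists z => //.
by rewrite /= /orbit_fun act0r addr0.
Qed.

Lemma tradP X (k : R[i]) (x y : X) : trad X x -> trad X y ->
  trad X (k *: x + y).
Proof.
move=> [V [f [sf [v _ <-]]]] [W [g [sg [w _ <-]]]].
exists (V * W)%type, (copair f g); split; first exact: small_copair.
by exists (k *: v, w) => //=; rewrite /copair_fun linearZ.
Qed.

Lemma trad_act X (a : A) (x : X) : trad X x -> trad X (act a x).
Proof.
move=> [V [f [sf [v _ <-]]]]; exists V, f; split=> //.
by exists (act a v) => //; rewrite bmor_act.
Qed.

(* Surjectivity of (y, a) |-> phi y + a x from Y * A to X is stable under small
   perturbations of x. *)
Lemma trad_closed X : unital_module X -> closed (trad X).
Proof.
move=> uX x /closureP_nr xt; apply/small_orbitP => //; apply/smallP => Y phi phiT.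
have [|C [C0 CP]] := approx_preimage (T := copair phi (orbit_map x)).
  by move=> z; have [y [a <-]] := phiT z; exists (y, a).
(* At this distance, replacing [x] by [x'] costs at most [C * nr f / (4 * C) = nr f / 4]; with the
   error [nr f / 4] from [CP] this makes the [nr f / 2] that [approx_surj] allows. *)
have [|x' tx' xx'] := xt (C *+ 4)^-1; first by rewrite invr_gt0 mulrn_wgt0.
have [M [_ MP]] := bmor_nr (copair phi (orbit_map x')).
have /smallP := orbit_sub_trad tx'; apply => z.
have [|[y a] <-] := approx_surj MP (C := C) _ z; last by exists y, a.
move=> f; have [e [eC ef]] := CP f; exists e; split=> //.
apply: le_trans (nr_triangle (copair phi (orbit_map x) e) _ _) _.
have -> : copair phi (orbit_map x) e - copair phi (orbit_map x') e =
    act (e.2 : A) (x - x').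
  by rewrite /= /copair_fun /= /orbit_fun actBr opprD addrACA subrr add0r.
have : nr (act (e.2 : A) (x - x')) <= nr e * nr (x - x').
  have : nr (act (e.2 : A) (x - x')) <= nr e.2 * nr (x - x').
    by rewrite -lecR rmorphM/= !nrE norm_act.
  move=> /le_trans; apply; rewrite ler_wpM2r ?nr_ge0//.
  exact: (nr_prod e).2.
have : nr e * nr (x - x') <= C * nr f * (C *+ 4)^-1.
  by apply: ler_pM; rewrite ?nr_ge0// ltW.
have -> : C * nr f * (C *+ 4)^-1 = nr f / 4.
  by rewrite -mulr_natr; field; rewrite gt_eqF.
by move: ef; lra.
Qed.

Lemma trad_submodule X : unital_module X -> closed_submodule (trad X).
Proof.
move=> uX; split; [exact: trad_closed|exact: trad0|exact: tradP|].
exact: trad_act.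
Qed.

(** * Maximal left ideals and the Jacobson radical *)

(** By Zorn's lemma: a left ideal is proper exactly when it misses [bone], and this property passes
    to unions of chains. *)
Lemma sub_maximal_left_ideal (L : set A) : left_ideal L -> ~ L bone ->
  exists I, [/\ maximal_left_ideal I, L `<=` I & ~ I bone].
Proof.
move=> Lid L1.
(* The empty set belongs to P only because Zorn_bigcup also takes the union of
   the empty chain. *)
pose P (J : set A) := J = set0 \/ [/\ left_ideal J, L `<=` J & ~ J bone].
have [F FP Ftot|I [PI maxI]] := @Zorn_bigcup A P.
  have [F0|] := pselect (forall J, F J -> J = set0).
    by left; apply: bigcup0.
  move=> /existsNP[J /not_implyP[FJ J0]]; right.
  have FJP K : F K -> K !=set0 -> [/\ left_ideal K, L `<=` K & ~ K bone].
    by move=> FK [z Kz]; case: (FP _ FK) => // K0; rewrite K0 in Kz.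
  have /FJP-/(_ FJ)[[JI0 _ _] LJ _] : J !=set0 by apply/set0P/eqP.
  split; first split.
  - by exists J.
  - move=> a b [Ka FKa Kaa] [Kb FKb Kbb].
    have [Kab|Kba] := Ftot _ _ FKa FKb.
      exists Kb => //; have [[_ KB _] _ _] := FJP _ FKb (ex_intro _ _ Kbb).
      by apply: KB => //; exact: Kab.
    exists Ka => //; have [[_ KB _] _ _] := FJP _ FKa (ex_intro _ _ Kaa).
    by apply: KB => //; exact: Kba.
  - move=> a b [K FK Kb]; exists K => //.
    by have [[_ _ KM] _ _] := FJP _ FK (ex_intro _ _ Kb); exact: KM.
  - by move=> z Lz; exists J => //; exact: LJ.
  - move=> [K FK K1].
    by have [_ _] := FJP _ FK (ex_intro _ _ K1); apply.
(* The maximal element is not empty, since [L] would strictly contain it. *)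
have [I0|[Iid LI I1]] := PI.
  case: (maxI L); last by right; split.
  rewrite I0; split=> // /(_ 0) /=; apply; by case: Lid.
exists I; split=> //; split=> //.
  by move=> IT; apply: I1; rewrite IT.
move=> J Jid IJ; have [J1|J1] := pselect (J bone); [right|left].
  rewrite -subTset => a _; have [_ _ /(_ a _ J1)] := Jid.
  by rewrite bmulx1.
apply/seteqP; split=> //; apply: contrapT => JI.
by apply: (maxI J); [split|right; split=> //; exact: subset_trans IJ].
Qed.

Lemma jacobson_trad (r : A) : jacobson_radical r -> trad (regular_module A) r.
Proof.
move=> rJ; have ureg : unital_module (regular_module A).
  by move=> a; exact: bmul1x.
apply/small_orbitP => //; apply/smallP => Y phi phiT.
have phiid : left_ideal (range phi : set A).
  split; first by exists 0 => //; rewrite linear0.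
    by move=> _ _ [y _ <-] [z _ <-]; exists (y - z) => //; rewrite linearB.
  by move=> a _ [y _ <-]; exists (act a y) => //; rewrite bmor_act.
have [phi1|phi1] := pselect (range phi (bone : A)).
  rewrite -subTset => a _; have [_ _ /(_ a _ phi1)] := phiid.
  by rewrite bmulx1.
have [I [Imax phiI I1]] := sub_maximal_left_ideal phiid phi1.
have [[I0 IB IM] _ _] := Imax; exfalso; apply: I1.
(* [bone] is [phi y] plus a multiple of [r], and both terms lie in [I]. *)
have [y [a <-]] := phiT (bone : A).
rewrite -[X in I (_ + X)]opprK; apply: (IB); first by apply: phiI; exists y.
rewrite -sub0r; apply: (IB) => //; apply: IM; exact: rJ.
Qed.

Lemma act_span_trad X :
  act_span X (@jacobson_radical R A) `<=` trad X.
Proof.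
move=> _ [n [c [s [sP ->]]]]; elim: n c s sP => [|n IH] c s sP.
  by rewrite big_ord0; exact: trad0.
rewrite big_ord_recl; apply: tradP; last by apply: IH => i; exact: sP.
have [r rJ [x _ <-]] := sP ord0.
exact: (trad_map (orbit_map x) (jacobson_trad rJ)).
Qed.

(** * The radical of quotient modules *)

Fact bquot_pi_bounded X (Z : set X) :
  exists M : R, forall x : X, `|bquot_pi Z x| <= M%:C * `|x|.
Proof.
by exists 1 => x; rewrite mul1r -[leLHS]nrE -(nrE x) lecR bquot_rnorm_le.
Qed.

Definition bquot_proj X (Z : set X) : bmorphism X (bquot Z) :=
  @BMorphism _ _ X (bquot Z) (bquot_pi Z) (@bquot_piA _ _ X Z)
    (bquot_pi_bounded Z).

Lemma trad_bquot_trad X : unital_module X ->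
  trad (bquot (trad X)) = [set 0].
Proof.
move=> uX; apply/seteqP; split=> [q tq|_ ->]; last exact: trad0.
have [x xq] := bquot_pi_surj q; rewrite -xq /=.
apply/(bquot_pi_eq0 x (trad_submodule uX)).
apply/small_orbitP => //; apply/smallP => Y phi phiT.
(* Modulo the radical phi is surjective, so x = phi y + t with t in the radical,
   and then the images of phi and of the orbit map of t span X. *)
have pT : range (bcomp (bquot_proj (trad X)) phi) = setT.
  (* The cover of [X] by [phi] and the orbit of [x] projects to a cover of the quotient, where the
     orbit map of [q] is small. *)
  move: tq => /orbit_sub_trad/smallP; apply => q'.
  have [x' <-] := bquot_pi_surj q'; have [y [a <-]] := phiT x'.
  exists y, a; rewrite bquot_piD -xq.
  by congr (_ + _); exact/esym/(@bquot_piA _ _ X (trad X)).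
have /seteqP[_ /(_ (bquot_pi (trad X) x) I)[y _]] := pT.
move=> /esym/bquot_piP; rewrite submodule_hull_id; last exact: trad_submodule.
move=> /orbit_sub_trad/smallP; apply => x'.
(* This is [phi z + a x = phi (z + a y) + a (x - phi y)], with [x - phi y] in the radical. *)
have [z [a <-]] := phiT x'; exists (z + act (a : A) y), a.
rewrite linearD/= bmor_act /orbit_fun actBr -addrA.
by congr (_ + _); rewrite addrC subrK.
Qed.

End radical.

Theorem theorem4p8 (R : realType) (A : banachAlgType R) (X : banachModType A)
    (hX : unital_module X) :
  (forall (Y : banachModType A) (phi : bmorphism X Y), unital_module Y ->
     [set phi x | x in trad X] `<=` trad Y)
  /\ (forall x0 : X, small (orbit_map x0) <-> trad X x0)
  /\ closure (act_span X (@jacobson_radical R A)) `<=` trad X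
  /\ trad (bquot (trad X)) = [set 0]
  /\ (forall Z : set X, closed_submodule Z -> trad (bquot Z) = [set 0] ->
       trad X `<=` Z).
Proof.
split; first by move=> Y phi _ _ [x tx <-]; exact: trad_map.
split; first by move=> x0; exact: small_orbitP.
split.
  rewrite (closure_id (trad X)).1; last exact: trad_closed.
  exact: closureS (@act_span_trad _ _ X).
split; first exact: trad_bquot_trad.
(* The projection maps the radical of [X] into that of the quotient, which is 0, and its kernel is
   [Z]. *)
move=> Z Zc Z0 x /(trad_map (bquot_proj Z)); rewrite Z0 /=.
by move=> /(bquot_pi_eq0 x Zc).
Qed.
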